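(* Let $c>0$ be a constant and let $H\subseteq\{1,\dots,n\}^2$ be a board with $A=|H|\ge c(u+v)^2$, where $u=|\{x:(x,y)\in H\}|$ and $v=|\{y:(x,y)\in H\}|$. Then there are constants $c_1,c_2>0$ depending only on $c$ such that $c_2A^{3/4}\le F(H)\le c_1A^{3/4}$.
   Context: Switching game on a board $H\subseteq\{1,\dots,n\}^2$: there is one switch for each row index $i\in H_x=\{x:(x,y)\in H\}$ and one for each column index $j\in H_y=\{y:(x,y)\in H\}$. An initial configuration is $a_{ij}\in\{-1,+1\}$ for $(i,j)\in H$; a switch setting is $x_i\in\{-1,+1\}$ ($i\in H_x$), $y_j\in\{-1,+1\}$ ($j\in H_y$). The signed discrepancy is $\sum_{(i,j)\in H}a_{ij}x_iy_j$ and the maximum discrepancy is $F(H)=\min_{(a_{ij})}\max_{(x_i),(y_j)}\sum_{(i,j)\in H}a_{ij}x_iy_j$. *)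

(* Defs.v *)
From HB Require Import structures.
From mathcomp Require Import all_boot all_order all_algebra.
From mathcomp Require Import all_classical all_reals all_analysis.

Set Implicit Arguments.
Unset Strict Implicit.
Unset Printing Implicit Defensive.

Import Order.TTheory GRing.Theory Num.Theory.
Local Open Scope ring_scope.

Section SwitchingGame.
Variable n : nat.

Definition board := {set 'I_n * 'I_n}.

Definition board_rows (H : board) : {set 'I_n} := [set p.1 | p in H].
Definition board_cols (H : board) : {set 'I_n} := [set p.2 | p in H].

(* A sign is encoded by a boolean b standing for (-1) ^+ b. Configurations and
   switch settings are total functions: the values outside H, resp. outside the
   rows and columns of H, do not occur in the signed discrepancy, so they affect
   neither the maximum nor the minimum below. *)
Definition configuration := {ffun 'I_n * 'I_n -> bool}.
Definition row_switches := {ffun 'I_n -> bool}.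
Definition col_switches := {ffun 'I_n -> bool}.

Definition signed_discrepancy (H : board) (a : configuration)
    (s : row_switches * col_switches) : int :=
  \sum_(p in H) (-1) ^+ a p * (-1) ^+ s.1 p.1 * (-1) ^+ s.2 p.2.

(* The index sets of the two extrema are finite and nonempty; the neutral
   element of each iterated extremum is one of the values it ranges over. *)
Definition max_signed_discrepancy (H : board) (a : configuration) : int :=
  \big[Num.max/signed_discrepancy H a ([ffun=> false], [ffun=> false])]_s
    signed_discrepancy H a s.

Definition max_discrepancy (H : board) : int :=
  \big[Num.min/max_signed_discrepancy H [ffun=> false]]_a
    max_signed_discrepancy H a.

End SwitchingGame.

(* Main.v *)
(* Lower bound: draw the column switches at random and then set every row switch
   so that its row contributes the absolute value of its signed sum.  A signed
   sum of d random signs has second moment d and fourth moment at most 3 d^2, so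
   for every t with d <= t^2 its expected absolute value is at least 5 d / (9 t).
   Taking t of order A^(1/4), which the density hypothesis allows, and adding up
   the rows gives order A / A^(1/4).

   Upper bound: draw the configuration at random.  For fixed switches the
   exponential moment of parameter l of the discrepancy is at most
   exp(2 l^2 A), and there are only 2^(u+v) switch settings, so some
   configuration satisfies l D <= u + v + 2 l^2 A for all of them; take
   l = 1 / (2 A^(1/4)). *)
Require Import Defs.
From HB Require Import structures.
From mathcomp Require Import all_boot all_order all_algebra.
From mathcomp Require Import all_classical all_reals all_analysis.
From mathcomp Require Import ring lra.

Set Implicit Arguments.
Unset Strict Implicit.
Unset Printing Implicit Defensive.

Import Order.TTheory GRing.Theory Num.Theory.
Local Open Scope ring_scope.

(** The averaging step of both bounds, with expectations written as unnormalised sums. The point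
    [i0] makes [I] nonempty, so that strict inequality everywhere would make the sums strictly
    ordered. *)
Lemma exists_le_of_sum_le (R : realDomainType) (I : finType) (i0 : I)
    (F G : I -> R) :
  \sum_i F i <= \sum_i G i -> exists i, F i <= G i.
Proof.
move=> hFG; apply/existsP; apply: contraLR hFG => /existsPn hGF.
rewrite -ltNge; apply: ltr_sum => [|i _]; last by rewrite ltNge hGF.
by apply/hasP; exists i0; rewrite ?mem_index_enum.
Qed.

(** * Moments of random signed sums *)

Section SignSums.
Variables (R : realType) (T : finType).

Definition flip (j : T) (y : {ffun T -> bool}) : {ffun T -> bool} :=
  [ffun i => y i (+) (i == j)].

Lemma flipK j : involutive (flip j).
Proof. by move=> y; apply/ffunP => i; rewrite !ffunE -addbA addbb addbF. Qed.

Lemma sum_flip_odd j (f : {ffun T -> bool} -> R) :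
  (forall y, f (flip j y) = - f y) -> \sum_y f y = 0.
Proof.
move=> hf; have : \sum_y f y = - \sum_y f y.
  rewrite -[RHS]sumrN (reindex_inj (inv_inj (flipK j))).
  by apply: eq_bigr => y _; rewrite hf.
lra.
Qed.

Definition sign_sum (b : T -> bool) (r : seq T) (y : {ffun T -> bool}) : R :=
  \sum_(j <- r) (-1) ^+ b j * (-1) ^+ y j.

Lemma sign_sum_cons b j r y :
  sign_sum b (j :: r) y = (-1) ^+ b j * (-1) ^+ y j + sign_sum b r y.
Proof. by rewrite /sign_sum big_cons. Qed.

Lemma sign_sum_flip b j r y : j \notin r ->
  sign_sum b r (flip j y) = sign_sum b r y.
Proof.
move=> jr; rewrite /sign_sum big_seq [RHS]big_seq; apply: eq_bigr => i ir.
rewrite ffunE; case: eqP => [ij|_]; last by rewrite addbF.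
by rewrite -ij ir in jr.
Qed.

(** Independence of coordinate [j] from [f]: flipping that coordinate pairs the terms into
    cancelling couples. It removes the odd cross terms in the moment computations. *)
Lemma sum_sign_mul b (f : {ffun T -> bool} -> R) j :
  (forall y, f (flip j y) = f y) ->
  \sum_(y : {ffun T -> bool}) (-1) ^+ b j * (-1) ^+ y j * f y = 0.
Proof.
move=> hf; apply: (@sum_flip_odd j) => y.
by rewrite hf ffunE eqxx signr_addb expr1 mulrN1 mulrN mulNr.
Qed.

Lemma second_moment b r : uniq r ->
  \sum_y sign_sum b r y ^+ 2 = #|{ffun T -> bool}|%:R * (size r)%:R.
Proof.
elim: r => [|j r IH] /=.
  by rewrite mulr0 big1 // => y _; rewrite /sign_sum big_nil expr0n.
move=> /andP[jr ur].
transitivity (\sum_(y : {ffun T -> bool})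
    (1 + (-1) ^+ b j * (-1) ^+ y j * (2 * sign_sum b r y) + sign_sum b r y ^+ 2)).
  apply: eq_bigr => y _; rewrite sign_sum_cons.
  rewrite sqrrD exprMn !sqrr_sign; ring.
rewrite !big_split /= (@sum_sign_mul b (fun y => 2 * sign_sum b r y));
  last by move=> y; rewrite sign_sum_flip.
by rewrite IH // sumr_const -natr1; ring.
Qed.

Lemma fourth_moment b r : uniq r ->
  \sum_y sign_sum b r y ^+ 4 <= #|{ffun T -> bool}|%:R * (3 * (size r)%:R ^+ 2).
Proof.
elim: r => [|j r IH] /=.
  by rewrite expr0n !mulr0 big1 // => y _; rewrite /sign_sum big_nil expr0n.
move=> /andP[jr ur].
have -> : \sum_y sign_sum b (j :: r) y ^+ 4 =
  \sum_(y : {ffun T -> bool}) (1 + (-1) ^+ b j * (-1) ^+ y j *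
                (4 * sign_sum b r y + 4 * sign_sum b r y ^+ 3)
            + 6 * sign_sum b r y ^+ 2 + sign_sum b r y ^+ 4).
  apply: eq_bigr => y _; rewrite sign_sum_cons.
  set s := sign_sum _ _ _; set e := _ * _.
  have e2 : e ^+ 2 = 1 by rewrite exprMn !sqrr_sign mulr1.
  have -> : (e + s) ^+ 4 = (e ^+ 2) ^+ 2 + e * (4 * e ^+ 2 * s + 4 * s ^+ 3)
     + 6 * e ^+ 2 * s ^+ 2 + s ^+ 4 by ring.
  by rewrite e2; ring.
rewrite !big_split /=.
rewrite (@sum_sign_mul b (fun y => 4 * sign_sum b r y + 4 * sign_sum b r y ^+ 3));
  last by move=> y; rewrite sign_sum_flip.
rewrite -mulr_sumr second_moment // sumr_const -natr1.
have := IH ur; set N := #|_|%:R => hN.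
have : 0 <= N by rewrite ler0n.
rewrite -[_ *+ _]mulr_natr -/N; nra.
Qed.

(* Pointwise [x - x^2 + 4/27 x^4 >= 0] for [x = |s|/t >= 0], as
   [27 - 27 x + 4 x^3 = (x + 3) (2 x - 3)^2]. *)
Lemma norm_ge_quartic (s t : R) : 0 < t ->
  s ^+ 2 / t - 4 / 27 * (s ^+ 4 / t ^+ 3) <= `|s|.
Proof.
move=> t0; rewrite -subr_ge0.
have -> : s ^+ 2 = `|s| ^+ 2 by rewrite real_normK ?num_real.
have -> : s ^+ 4 = `|s| ^+ 4 by rewrite -normrX ger0_norm // exprn_even_ge0.
set z := `|s|; have z0 : 0 <= z by rewrite normr_ge0.
have -> : z - (z ^+ 2 / t - 4 / 27 * (z ^+ 4 / t ^+ 3)) =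
  z * (z / t + 3) * (2 * (z / t) - 3) ^+ 2 / 27.
  by field; rewrite gt_eqF.
have zt : 0 <= z / t by rewrite divr_ge0 // ltW.
by rewrite divr_ge0 // mulr_ge0 ?sqr_ge0 // mulr_ge0 // addr_ge0.
Qed.

Lemma first_absolute_moment b r (t : R) : uniq r -> 0 < t ->
  (size r)%:R <= t ^+ 2 ->
  #|{ffun T -> bool}|%:R * (5 / 9 * ((size r)%:R / t)) <=
  \sum_(y : {ffun T -> bool}) `|sign_sum b r y|.
Proof.
move=> ur t0 rt; set N := #|_|%:R.
apply: (@le_trans _ _ (\sum_(y : {ffun T -> bool}) (sign_sum b r y ^+ 2 / t
          - 4 / 27 * (sign_sum b r y ^+ 4 / t ^+ 3)))); last first.
  by apply: ler_sum => y _; apply: norm_ge_quartic.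
rewrite big_split /= sumrN -mulr_sumr -!mulr_suml second_moment // -/N.
have h4 := fourth_moment b ur; rewrite -/N in h4.
have : (\sum_y sign_sum b r y ^+ 4) / t ^+ 3 <= N * 3 * ((size r)%:R / t).
  rewrite ler_pdivrMr ?exprn_gt0 //; apply: (le_trans h4).
  have -> : N * 3 * ((size r)%:R / t) * t ^+ 3 = N * (3 * ((size r)%:R * t ^+ 2)).
    by field; rewrite gt_eqF.
  by rewrite ler_wpM2l ?ler0n // ler_wpM2l // expr2 ler_wpM2l.
(* The constant is [5/9 = 1 - 3 * 4/27]. *)
lra.
Qed.

(** Only [1 + x <= expR x] is used: inverted, it bounds the left side by [2 / (1 - x^2)], and
    [(1 + 2 x^2) (1 - x^2) >= 1] exactly when [x^2 <= 1/2]. *)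
Lemma cosh_le (x : R) : x ^+ 2 <= 1 / 2 ->
  expR x + expR (- x) <= 2 * expR (2 * x ^+ 2).
Proof.
move=> hx.
have xlt1 : x < 1 by nra.
have xgt1 : - 1 < x by nra.
have h1 : expR x <= (1 - x)^-1.
  rewrite -[x in expR x]opprK expRN lef_pV2 ?posrE ?expR_gt0 ?subr_gt0 //.
  exact: expR_ge1Dx.
have h2 : expR (- x) <= (1 + x)^-1.
  rewrite expRN lef_pV2 ?posrE ?expR_gt0 //; first exact: expR_ge1Dx.
  by lra.
apply: (@le_trans _ _ (2 * (1 + 2 * x ^+ 2))); last first.
  by rewrite ler_wpM2l // expR_ge1Dx.
apply: (le_trans (lerD h1 h2)).
have -> : (1 - x)^-1 + (1 + x)^-1 = 2 / (1 - x ^+ 2).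
  field.
  by apply/and3P; split; apply/eqP; nra.
rewrite ler_wpM2l // -[_^-1]mul1r ler_pdivrMr; nra.
Qed.

Lemma exponential_moment (H : {set T}) (b : T -> bool) (l : R) :
  l ^+ 2 <= 1 / 2 ->
  \sum_(a : {ffun T -> bool})
    expR (l * \sum_(p in H) (-1) ^+ a p * (-1) ^+ b p) <=
  #|{ffun T -> bool}|%:R * expR (2 * l ^+ 2 * #|H|%:R).
Proof.
move=> hl.
(* The factor 1 outside [H] extends the product to all of [T], so the sum over [a] factorises into
   one two-term sum per cell. *)
pose F p (e : bool) : R := if p \in H then expR (l * ((-1) ^+ e * (-1) ^+ b p)) else 1.
have -> : \sum_(a : {ffun T -> bool})
    expR (l * \sum_(p in H) (-1) ^+ a p * (-1) ^+ b p) =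
  \sum_(a : {ffun T -> bool}) \prod_p F p (a p).
  by apply: eq_bigr => a _; rewrite mulr_sumr expR_sum big_mkcond.
rewrite -bigA_distr_bigA /=.
have -> : #|{ffun T -> bool}|%:R * expR (2 * l ^+ 2 * #|H|%:R) =
  \prod_p (2 * if p \in H then expR (2 * l ^+ 2) else 1) :> R.
  rewrite big_split /= prodr_const -big_mkcond /= prodr_const.
  by rewrite card_ffun card_bool natrX -expRM_natl [_ * #|H|%:R]mulrC.
apply: ler_prod => p _; rewrite big_bool /F /=; case: ifP => _; last first.
  by apply/andP; split; lra.
rewrite addr_ge0 ?expR_ge0 /=; [|by []..]; case: (b p).
all: by have := cosh_le hl; rewrite ?expr1 ?expr0
  ?(mulr1, mulrN1, opprK, mulrN, mul1r, mulN1r); lra.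
Qed.

End SignSums.

(** * From moments to discrepancy bounds *)

Section Discrepancy.
Variables (R : realType) (n : nat).
Implicit Types (H : board n) (a : configuration n).

Lemma intr_signed_discrepancy H a s :
  (signed_discrepancy H a s)%:~R =
  \sum_(p in H) (-1) ^+ a p * (-1) ^+ s.1 p.1 * (-1) ^+ s.2 p.2 :> R.
Proof.
rewrite /signed_discrepancy rmorph_sum; apply: eq_bigr => p _.
by rewrite !rmorphM /= !rmorph_sign.
Qed.

Definition row_support H (i : 'I_n) : {set 'I_n} := [set j | (i, j) \in H].

Lemma sum_row_support H (F : 'I_n * 'I_n -> R) :
  \sum_(p in H) F p = \sum_i \sum_(j in row_support H i) F (i, j).
Proof.
rewrite pair_big_dep /=; apply: eq_big => [p|p _]; case: p => i j //=.
by rewrite inE.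
Qed.

Lemma card_row_support_le H i : (#|row_support H i| <= #|board_cols H|)%N.
Proof.
apply/subset_leq_card/fintype.subsetP => j; rewrite inE => ij.
by apply/imsetP; exists (i, j).
Qed.

Lemma exists_large_discrepancy H a (t : R) : 0 < t ->
  #|board_cols H|%:R <= t ^+ 2 ->
  exists s, 5 / 9 * (#|H|%:R / t) <= (signed_discrepancy H a s)%:~R.
Proof.
move=> t0 ht.
pose S i := sign_sum R (fun j => a (i, j)) (enum (row_support H i)).
have [] := @exists_le_of_sum_le R {ffun 'I_n -> bool} [ffun=> false]
  (fun=> 5 / 9 * (#|H|%:R / t)) (fun y => \sum_i `|S i y|).
  rewrite sumr_const -[_ *+ _]mulr_natl exchange_big /=.
  have -> : #|H|%:R = \sum_i (size (enum (row_support H i)))%:R :> R.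
    rewrite -sumr_const sum_row_support; apply: eq_bigr => i _.
    by rewrite sumr_const -cardE.
  rewrite mulr_suml !mulr_sumr; apply: ler_sum => i _.
  apply: first_absolute_moment => //; first exact: enum_uniq.
  by rewrite -cardE (le_trans _ ht) // ler_nat card_row_support_le.
(* Each row switch is turned exactly when its row sum is negative, which replaces that sum by its
   absolute value. *)
move=> y hy; exists ([ffun i => S i y < 0], y); apply: (le_trans hy).
rewrite intr_signed_discrepancy sum_row_support le_eqVlt; apply/orP; left.
apply/eqP/eq_bigr => i _.
transitivity ((-1) ^+ (S i y < 0)%R * S i y).
  case: ltP => h; first by rewrite expr1 mulN1r ltr0_norm.
  by rewrite expr0 mul1r ger0_norm.
rewrite {2}/S /sign_sum big_enum mulr_sumr; apply: eq_bigr => j _ /=.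
by rewrite ffunE; ring.
Qed.

(* Only the 2^(u+v) restricted switch settings enter the union bound, instead of
   all 2^(2n) settings on which [signed_discrepancy] is defined. *)
Definition restrict (A : {set 'I_n}) (f : {ffun 'I_n -> bool}) :
  {ffun 'I_n -> bool} := [ffun i => (i \in A) && f i].

Lemma restrict_pffun_on (A : {set 'I_n}) f :
  restrict A f \in pffun_on false [in A] predT.
Proof.
by apply/pffun_onP; split=> //; apply/supportP => i /negbTE iA; rewrite ffunE iA.
Qed.

Lemma signed_discrepancy_restrict H a s : signed_discrepancy H a
    (restrict (board_rows H) s.1, restrict (board_cols H) s.2) =
  signed_discrepancy H a s.
Proof.
apply: eq_bigr => p pH; rewrite !ffunE /board_rows /board_cols.
by rewrite !imset_f.
Qed.

Lemma exists_small_discrepancy H (l : R) : l ^+ 2 <= 1 / 2 ->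
  exists a, forall s, l * (signed_discrepancy H a s)%:~R <=
    #|board_rows H|%:R + #|board_cols H|%:R + 2 * l ^+ 2 * #|H|%:R.
Proof.
move=> hl.
pose P : pred (row_switches n * col_switches n) :=
  fun s => (s.1 \in pffun_on false [in board_rows H] predT) &&
           (s.2 \in pffun_on false [in board_cols H] predT).
set M := _ + _ + _.
have cardP : #|P|%:R <= expR (#|board_rows H|%:R + #|board_cols H|%:R) :> R.
  have -> : #|P| = (2 ^ (#|board_rows H| + #|board_cols H|))%N.
    transitivity #|[predX pffun_on false [in board_rows H] (@predT bool)
                        & pffun_on false [in board_cols H] (@predT bool)]|.
      by apply: eq_card => s.
    by rewrite cardX !card_pffun_on card_bool expnD.
  rewrite -natrD -[(_ + _)%:R]mulr1 expRM_natl natrX lerXn2r ?nnegrE ?expR_ge0 //.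
  (* Here [2 <= expR 1], so [2^(u+v) <= expR (u+v)]. *)
  by have := @expR_ge1Dx R 1; lra.
have [] := @exists_le_of_sum_le R (configuration n) [ffun=> false]
  (fun a => \sum_(s | P s) expR (l * (signed_discrepancy H a s)%:~R))
  (fun=> #|P|%:R * expR (2 * l ^+ 2 * #|H|%:R)).
  rewrite exchange_big /= sumr_const -[_ *+ _]mulr_natl mulrCA.
  rewrite -sumr_const mulr_suml; apply: ler_sum => s _; rewrite mul1r.
  (* For fixed switches, the row and column signs at a cell merge into one sign, the xor of the two
     booleans. *)
  have := @exponential_moment R _ H (fun p => s.1 p.1 (+) s.2 p.2) l hl.
  congr (_ <= _); apply: eq_bigr => a _; congr (expR (_ * _)).
  rewrite intr_signed_discrepancy; apply: eq_bigr => p _.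
  by rewrite signr_addb mulrA.
move=> a ha; exists a => s; rewrite -signed_discrepancy_restrict.
set s' := (_, _).
have Ps' : P s' by rewrite /P /= !restrict_pffun_on.
rewrite -ler_expR /M expRD.
apply: (@le_trans _ _ (#|P|%:R * expR (2 * l ^+ 2 * #|H|%:R))); last first.
  by rewrite ler_wpM2r // expR_ge0.
(* A single exponential is at most the sum of all of them. *)
apply: le_trans ha; rewrite (bigD1 s') //= lerDl.
by apply: sumr_ge0 => i _; rewrite expR_ge0.
Qed.

Lemma max_discrepancy_ge H (m : R) :
  (forall a, exists s, m <= (signed_discrepancy H a s)%:~R) ->
  m <= (max_discrepancy H)%:~R.
Proof.
move=> h; have hmax a : m <= (max_signed_discrepancy H a)%:~R.
  by have [s hs] := h a; apply: (le_trans hs); rewrite ler_int le_bigmax.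
rewrite /max_discrepancy; elim/big_ind: _ => // x y hx hy.
by rewrite /Num.min; case: ifP.
Qed.

Lemma max_discrepancy_le H (m : R) a :
  (forall s, (signed_discrepancy H a s)%:~R <= m) ->
  (max_discrepancy H)%:~R <= m.
Proof.
move=> h; apply: (@le_trans _ _ (max_signed_discrepancy H a)%:~R).
  by rewrite ler_int bigmin_le_cond.
rewrite /max_signed_discrepancy; elim/big_ind: _ => // x y hx hy.
by rewrite /Num.max; case: ifP.
Qed.

End Discrepancy.

(** * Choice of parameters and constants *)

Theorem theorem6 (R : realType) (c : R) (hc : 0 < c) :
  exists c1 c2 : R, [/\ 0 < c1, 0 < c2 &
    forall (n : nat) (H : board n),
      c * (#|board_rows H|%:R + #|board_cols H|%:R) ^+ 2 <= #|H|%:R ->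
      c2 * #|H|%:R `^ (3%:R / 4%:R) <= (max_discrepancy H)%:~R /\
      (max_discrepancy H)%:~R <= c1 * #|H|%:R `^ (3%:R / 4%:R)].
Proof.
pose k := c `^ 4^-1.
have k0 : 0 < k by rewrite powR_gt0.
have k4 : k ^+ 4 = c.
  by rewrite -powR_mulrn ?powR_ge0 // -powRrM mulVf // powRr1 // ltW.
exists (2 / k ^+ 2 + 1), (5 / 9 * k); split.
- by rewrite addr_gt0 // divr_gt0 // exprn_gt0.
- by rewrite mulr_gt0.
move=> n H; set w := _ + _; set A := #|H|%:R => hA.
have w0 : 0 <= w by rewrite addr_ge0.
(* The empty board is treated apart, since both parameters below need [q = A^(1/4)] to be
   positive. *)
case: (eqVneq #|H| 0%N) => [H0|Hn0].
  have D0 a s : (signed_discrepancy H a s)%:~R = 0 :> R.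
    by rewrite /signed_discrepancy (cards0_eq H0) big_set0.
  rewrite /A H0 powR0 ?mulf_neq0 ?invr_eq0 ?pnatr_eq0 // !mulr0; split.
    apply: max_discrepancy_ge => a; exists ([ffun=> false], [ffun=> false]).
    by rewrite D0.
  by apply: (@max_discrepancy_le _ _ _ _ [ffun=> false]) => s; rewrite D0.
have A1 : 1 <= A by rewrite ler1n lt0n.
pose q := A `^ 4^-1.
have q0 : 0 < q by rewrite powR_gt0 // (lt_le_trans ltr01).
have q4 : q ^+ 4 = A.
  by rewrite -powR_mulrn ?powR_ge0 // -powRrM mulVf // powRr1 // (le_trans ler01).
have q3 : A `^ (3%:R / 4%:R) = q ^+ 3.
  by rewrite -[q ^+ 3]powR_mulrn ?powR_ge0 // -powRrM mulrC.
have q1 : 1 <= q ^+ 2.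
  by rewrite -(@ler_pXn2r _ 2) ?nnegrE ?sqr_ge0 // expr1n -exprM q4.
(* The square root of the density hypothesis. *)
have wq : k ^+ 2 * w <= q ^+ 2.
  rewrite -(@ler_pXn2r _ 2) ?nnegrE ?mulr_ge0 ?(ltW k0) ?(ltW q0) //.
  by rewrite exprMn -!exprM k4 q4.
rewrite q3; split.
  apply: max_discrepancy_ge => a.
  (* By [wq], [t = q / k] satisfies [t^2 >= w], and [A / t = k q^3]. *)
  have [||s hs] := @exists_large_discrepancy R n H a (q / k).
  - by rewrite divr_gt0.
  - apply: (@le_trans _ _ w); first by rewrite lerDr.
    by rewrite expr_div_n ler_pdivlMr ?exprn_gt0 // mulrC.
  exists s; apply: le_trans hs; rewrite -/A -q4 le_eqVlt; apply/orP; left.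
  by apply/eqP; field; rewrite !gt_eqF.
have [|a ha] := @exists_small_discrepancy R n H (2 * q)^-1.
  rewrite exprVn exprMn -[_^-1]mul1r ler_pdivrMr; first by lra.
  by rewrite mulr_gt0 // exprn_gt0.
apply: (@max_discrepancy_le _ _ _ _ a) => s.
have := ha s; rewrite -/w -/A -q4 mulrC ler_pdivrMr ?mulr_gt0 // => /le_trans; apply.
(* By [wq], the term [2 q w] is at most [(2 / k^2) q^3], whence the value of [c1]. *)
have -> : (w + 2 * (2 * q)^-1 ^+ 2 * q ^+ 4) * (2 * q) = 2 * q * w + q ^+ 3.
  by field; rewrite gt_eqF.
rewrite (mulrDl (2 / k ^+ 2)) mul1r lerD2r.
have -> : 2 / k ^+ 2 * q ^+ 3 = 2 * q * (q ^+ 2 / k ^+ 2) by field; rewrite gt_eqF.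
rewrite ler_wpM2l ?mulr_ge0 ?(ltW q0) // ler_pdivlMr ?exprn_gt0 //.
by rewrite mulrC.
Qed.
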